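(* Let $n\ge2$, let $\Omega:\{0,\dots,n\}\to[0,\infty)$ be a non-increasing function and let $f,g:Q_n\to[0,\infty)$. If $$\sqrt{f(x)g(y)}\le\Omega\big(n-d_H(x,y)\big)\qquad\text{for all }x,y\in Q_n,$$ then $$\sqrt{\int_{Q_n}f\,d\mu_n\int_{Q_n}g\,d\mu_n}\le\sum_{j=0}^n\Omega(j)\,\Delta F_n(j).$$
   Context: $Q_n=\{0,1\}^n$ with the Hamming distance $d_H(x,y)=\sum_{i=1}^n|x_i-y_i|$ and the uniform probability measure $\mu_n$. For $A\subset Q_n$ and $k\in\{0,\dots,n\}$, $A_k=\{x\in Q_n:d_H(x,A)\le k\}$ (with $\emptyset_k=\emptyset$), and $\#A$ is the cardinality of $A$. For $0\le m\le2^n$, $I_m$ is the set of the first $m$ elements of $Q_n$ in simplicial order: identifying elements of $Q_n$ with subsets of $\{1,\dots,n\}$, order first by cardinality, and lexicographically within each cardinality layer ($x$ precedes $y$ if the smallest element of the symmetric difference $x\triangle y$ belongs to $x$). Define $F_n(-1)=0$, $F_n(n)=1$ and $$F_n(j)=\max_{0\le m\le2^n}\Big[\frac{m}{2^n}\Big(1-\frac{\#(I_m)_{n-j-1}}{2^n}\Big)\Big]^{1/2},\qquad j=0,\dots,n-1,$$ and $\Delta F_n(j)=F_n(j)-F_n(j-1)$ for $j=0,\dots,n$. *)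

(* Defs.v *)
From HB Require Import structures.
From mathcomp Require Import all_boot all_order all_algebra.
From mathcomp Require Import reals.

Set Implicit Arguments.
Unset Strict Implicit.
Unset Printing Implicit Defensive.

Import Order.TTheory GRing.Theory Num.Theory.

Local Open Scope ring_scope.

Definition cube (n : nat) := {ffun 'I_n -> bool}.

Definition hamming (n : nat) (x y : cube n) : nat :=
  (\sum_(i < n) `|(x i : nat) - (y i : nat)|)%N.

(* d_H(x, A) <= k, the distance to A being a minimum over a finite set; this
   is empty when A is empty. *)
Definition enlarge (n : nat) (A : {set cube n}) (k : nat) : {set cube n} :=
  [set x : cube n | [exists y in A, (hamming x y <= k)%N]].

Definition support_set (n : nat) (x : cube n) : {set 'I_n} := [set i | x i].

(* The smallest element of the symmetric difference of S and T lies in S. *)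
Definition lex_lt (n : nat) (S T : {set 'I_n}) : bool :=
  [exists i in S :\: T,
     [forall j : 'I_n, (j < i)%N ==> ((j \in S) == (j \in T))]].

Definition simplicial_le (n : nat) : rel (cube n) := fun x y =>
  let S := support_set x in
  let T := support_set y in
  [|| x == y, (#|S| < #|T|)%N | (#|S| == #|T|) && lex_lt S T].

Definition initial_segment (n m : nat) : {set cube n} :=
  [set x in take m (sort (@simplicial_le n) (enum {: cube n}))].

(* The function F_n on {-1, ..., n}, extended by 0 below -1 and by 1 above n.
   The maximum is over nonnegative numbers, so its default value 0 is
   harmless. *)
Definition isoF (R : realType) (n : nat) (j : int) : R :=
  match j with
  | Negz _ => 0
  | Posz k =>
    if (k < n)%N then
      \big[Num.max/0]_(m < (2 ^ n).+1)
        Num.sqrt (m%:R / 2 ^+ n *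
          (1 - #|enlarge (initial_segment n m) (n - k - 1)|%:R / 2 ^+ n))
    else 1
  end.

Definition deltaF (R : realType) (n j : nat) : R :=
  isoF R n j%:Z - isoF R n (j%:Z - 1).

(* Integral with respect to the uniform probability measure on the cube. *)
Definition cube_integral (R : realType) (n : nat) (f : cube n -> R) : R :=
  \sum_(x : cube n) f x / 2 ^+ n.

(* Main.v *)
Require Import Defs.
From mathcomp Require Import all_boot all_order all_algebra zify lra ring.
From mathcomp Require Import reals.

(* Harper's theorem says that, among subsets of the cube of a given size, the
   initial segment of the simplicial order has the smallest k-neighbourhood;
   hence if A and B are at distance at least n - j, the geometric mean of their
   measures is at most F_n(j).  Applied to the level sets {f >= s} and {g >= t},
   this bounds the geometric mean of their measures by F_n(j) for the largest j
   with sqrt(s t) <= Omega(j), which is the slope of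
     H(r) = sum_j min(r, Omega(j)) DeltaF_n(j)
   at r = sqrt(s t).  The multiplicative one-dimensional Prekopa-Leindler
   inequality, proved by transport, then turns the bound on level sets into
   sqrt(int f int g) <= H(oo).

   Harper's theorem is proved by compressing along each coordinate i, i.e.
   replacing both sections by initial segments of the lower-dimensional cube.
   A fully compressed set that is not an initial segment is an initial segment
   whose last element x has been replaced by its successor y, and y is the
   complement of x; this case is checked directly. *)

Set Implicit Arguments.
Unset Strict Implicit.
Unset Printing Implicit Defensive.

(** * The simplicial order *)

Section Key.
Variable n : nat.
Implicit Types S T : {set 'I_n}.

(* An additive function whose order is the simplicial one (see [leq_key]): the
   constant 2 ^ n counts elements, and the powers of 2 encode the lexicographic
   order. *)
Definition key S : nat := \sum_(i in S) (2 ^ n - 2 ^ (n - i.+1)).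

(** Splits [key] into a cardinality part and a bit part without truncated subtraction; the bit part
    always stays below [2 ^ n], so cardinality decides first. *)
Lemma key_bits S :
  key S + \sum_(i in S) 2 ^ (n - i.+1) = #|S| * 2 ^ n.
Proof.
rewrite /key -big_split /= -sum_nat_const; apply: eq_bigr => i _.
by rewrite subnK // leq_exp2l // leq_subr.
Qed.

Lemma bits_tail S k : k <= n -> {in S, forall i : 'I_n, k <= i} ->
  \sum_(i in S) 2 ^ (n - i.+1) < 2 ^ (n - k).
Proof.
move=> kn Sk.
have tail d k' : k' + d = n -> (\sum_(k' <= i < n) 2 ^ (n - i.+1)).+1 = 2 ^ d.
  elim: d k' => [|d IH] k' kd; first by rewrite big_geq //; lia.
  rewrite big_ltn ?expnS; last by lia.
  have := IH k'.+1 ltac:(lia).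
  have -> : n - k'.+1 = d by lia.
  lia.
rewrite -(tail (n - k) k) ?ltnS; last by lia.
rewrite big_geq_mkord [leqLHS]big_mkcond [leqRHS]big_mkcond /=; apply: leq_sum => i _.
by case: ifP => // /Sk ki; rewrite ki.
Qed.

Lemma bits_lt S : \sum_(i in S) 2 ^ (n - i.+1) < 2 ^ n.
Proof. by rewrite -[X in _ < 2 ^ X]subn0; apply: bits_tail. Qed.

Lemma key_card S T : #|S| < #|T| -> key S < key T.
Proof.
move=> ST; have := key_bits S; have := key_bits T.
have := bits_lt T; nia.
Qed.

(** At the first difference [i], which lies in [S], the bit of [i] outweighs all later bits of [T]
    by [bits_tail]. Bits enter [key] negatively, so [S] has the smaller key. *)
Lemma key_lex S T : #|S| = #|T| -> lex_lt S T -> key S < key T.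
Proof.
move=> ST /existsP[i /andP[]]; rewrite inE => /andP[iT iS] /forallP agree.
have := key_bits S; have := key_bits T; rewrite ST.
suff: \sum_(i in T) 2 ^ (n - i.+1) < \sum_(i in S) 2 ^ (n - i.+1) by lia.
rewrite (bigID (fun j : 'I_n => j < i)) [ltnRHS](bigID (fun j : 'I_n => j < i)).
rewrite /= (eq_bigl (fun j => (j \in S) && (j < i))); last first.
  by move=> j; have := agree j; case: (j < i); rewrite ?andbF //= => /eqP->.
rewrite ltn_add2l (bigD1 (P := fun j => (j \in S) && _) i) ?iS ?ltnn //=.
apply: leq_trans (leq_addr _ _).
rewrite (eq_bigl (fun j => j \in [set k in T | i < k])).
  by apply: bits_tail => // j; rewrite inE => /andP[].
move=> j; rewrite inE -leqNgt leq_eqVlt; case: eqVneq => [ij|//].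
by rewrite -(ord_inj ij) (negbTE iT).
Qed.

Lemma lex_total S T : S != T -> lex_lt S T || lex_lt T S.
Proof.
move=> ST.
have [k0 k0P] : exists k, (k \in S) != (k \in T).
  apply/existsP; rewrite -negb_forall; apply: contra ST => /forallP E.
  by apply/eqP/setP => k; exact/eqP.
case: (@arg_minnP _ k0 (fun k => (k \in S) != (k \in T)) val k0P) => i iP imin.
have agree (j : 'I_n) : j < i -> (j \in S) = (j \in T).
  by move=> ji; apply/eqP; apply: contraLR ji => /imin; rewrite -leqNgt.
apply/orP; case iS: (i \in S) iP; case iT: (i \in T) => // _; [left|right];
  apply/existsP; exists i; rewrite inE iS iT /=; apply/forallP => j;
  by apply/implyP => /agree->.
Qed.

Lemma key_inj : injective key.
Proof.
move=> S T E; apply/eqP; apply: contraT => ST.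
case: (ltngtP #|S| #|T|) => [/key_card|/key_card|C]; try lia.
by case/orP: (lex_total ST) => /key_lex; lia.
Qed.

Lemma leq_key S T :
  (key S <= key T) = [|| S == T, #|S| < #|T| | (#|S| == #|T|) && lex_lt S T].
Proof.
have [->|ST] := eqVneq S T; first by rewrite leqnn.
case: (ltngtP #|S| #|T|) => [/key_card|/key_card|C] /=; [lia|lia|].
apply/idP/idP => [le|/(key_lex C)/ltnW//].
by case/orP: (lex_total ST) => // /key_lex; lia.
Qed.

Lemma keyU1 e S : e \notin S -> key (e |: S) = (2 ^ n - 2 ^ (n - e.+1)) + key S.
Proof. by move=> eS; rewrite /key big_setU1. Qed.

Lemma keyD1 e S : e \in S -> key S = (2 ^ n - 2 ^ (n - e.+1)) + key (S :\ e).
Proof. by move=> eS; rewrite /key (big_setD1 e). Qed.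

Lemma key_cancel e S T : e \notin S -> e \notin T ->
  (key (e |: S) <= key (e |: T)) = (key S <= key T).
Proof. by move=> eS eT; rewrite !keyU1 // leq_add2l. Qed.

End Key.

(** * Removing the largest element of a set *)

Section DropMax.
Variable n : nat.
Implicit Types x y z : {set 'I_n}.

(* Removing the largest element gives the simplicially smallest set below [x],
   so that a nonempty [x] is in the neighbourhood of an initial segment iff
   [dropmax x] is in the segment (see [nbhd_initialE]). *)
Definition dropmax x := [set e in x | [exists j in x, e < j]].

Lemma dropmaxP x : x != set0 ->
  exists m, [/\ m \in x, forall e, e \in x -> e <= m & dropmax x = x :\ m].
Proof.
case/set0Pn => e0 e0x; have [m mx mmax] := @arg_maxnP _ e0 (mem x) val e0x.
exists m; split => //; apply/setP => e; rewrite !inE andbC.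
case ex: (e \in x); rewrite ?andbF ?andbT //=.
apply/existsP/idP => [[j /andP[jx ej]]|em].
  by apply/eqP => em; have := mmax j jx; rewrite /= leqNgt -em ej.
by exists m; rewrite [m \in x]mx ltn_neqAle em; apply: mmax.
Qed.

Lemma key_dropmax_min x e : e \in x -> key (dropmax x) <= key (x :\ e).
Proof.
move=> ex; have [|m [mx mmax ->]] := @dropmaxP x.
  by apply/set0Pn; exists e.
have := keyD1 ex; have := keyD1 mx.
have : 2 ^ (n - m.+1) <= 2 ^ (n - e.+1).
  by rewrite leq_exp2l //; apply: leq_sub2l; rewrite ltnS mmax.
lia.
Qed.

Lemma key_dropmax_lt x : x != set0 -> key (dropmax x) < key x.
Proof.
case/dropmaxP => m [mx _ ->]; apply: key_card.
by rewrite [ltnRHS](cardsD1 m) mx.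
Qed.

(** For equal cardinalities, suppose [dropmax y] came first, with first difference [i]. If [i] is
    below the maximum of [x], the same [i] puts [y] before [x]; otherwise [dropmax x] is contained
    in [dropmax y], and the two are equal. *)
Lemma dropmax_mono x y : x != set0 -> y != set0 ->
  key x <= key y -> key (dropmax x) <= key (dropmax y).
Proof.
move=> /dropmaxP[m [mx mmax Dx]] /dropmaxP[m' [my mmax' Dy]] xy.
have cx := cardsD1 m x; have cy := cardsD1 m' y.
rewrite mx -Dx in cx; rewrite my -Dy in cy.
case: (ltngtP #|x| #|y|) => [|/key_card|] cxy; [|lia|].
  by apply/ltnW/key_card; lia.
rewrite leqNgt; apply/negP => lt.
have : lex_lt (dropmax y) (dropmax x).
  have := ltnW lt; rewrite leq_key => /or3P[/eqP E||/andP[]//]; last by lia.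
  by rewrite E ltnn in lt.
case/existsP => i /andP[]; rewrite in_setD => /andP[iDx iDy] /forallP agree.
have [mi|im] := leqP m i.
  have sub : dropmax x \subset dropmax y.
    apply/subsetP => e eDx; have := agree e; rewrite eDx => /implyP ag.
    suff /ag/eqP-> : e < i by [].
    rewrite ltn_neqAle; apply/andP; split.
      by apply: contraNN iDx => /eqP/ord_inj <-.
    by apply: leq_trans mi; apply: mmax; move: eDx; rewrite Dx => /setD1P[].
  have /eqP E : dropmax x == dropmax y by rewrite eqEcard sub; lia.
  by rewrite E iDy in iDx.
have iy : i \in y by move: iDy; rewrite Dy => /setD1P[].
suff /(key_lex (esym cxy)) : lex_lt y x by rewrite ltnNge xy.
apply/existsP; exists i; rewrite in_setD iy andbT; apply/andP; split.
  by apply: contra iDx => ix; rewrite Dx !inE ix andbT -val_eqE neq_ltn im.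
apply/forallP => j; apply/implyP => ji; have := agree j.
rewrite ji /= Dx Dy !inE -!val_eqE /=.
have -> : (j != m :> nat) by rewrite neq_ltn (ltn_trans ji im).
by have -> : (j != m' :> nat) by rewrite neq_ltn (leq_trans ji (mmax' _ iy)).
Qed.

End DropMax.

(** * Neighbourhoods and initial segments in a subcube *)

Section Neighbourhood.
Variable n : nat.
Implicit Types (x y z T : {set 'I_n}) (A B C : {set {set 'I_n}}) (i : 'I_n).

(** The Hamming neighbourhood of radius 1 inside the subcube of subsets of [T]. One of [e |: z] and
    [z :\ e] is [z] itself and the other is its flip at [e]. *)
Definition nbhd T A : {set {set 'I_n}} :=
  [set z in powerset T | (z \in A) ||
     [exists e in T, (e |: z \in A) || (z :\ e \in A)]].

Definition initial T B :=
  (B \subset powerset T) &&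
  [forall x in powerset T, forall y in B, (key x <= key y) ==> (x \in B)].

Lemma initialP T B :
  reflect (B \subset powerset T /\
    forall x y, x \subset T -> y \in B -> key x <= key y -> x \in B)
    (initial T B).
Proof.
apply: (iffP andP) => [[BT /forall_inP ini]|[BT ini]]; split=> //.
  move=> x y xT yB; have /forall_inP := ini x ltac:(by rewrite inE).
  by move=> /(_ y yB)/implyP.
apply/forall_inP => x; rewrite inE => xT.
by apply/forall_inP => y yB; apply/implyP; apply: ini.
Qed.

Lemma nbhd_sub T A : nbhd T A \subset powerset T.
Proof. by apply/subsetP => z; rewrite inE => /andP[]. Qed.

Lemma mem_nbhd T A z : z \subset T -> z \in A -> z \in nbhd T A.
Proof. by move=> zT zA; rewrite !inE zT zA. Qed.

Lemma mem_nbhdU T A z e : z \subset T -> e \in T -> e |: z \in A ->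
  z \in nbhd T A.
Proof.
move=> zT eT zA; rewrite !inE zT /=; apply/orP; right.
by apply/exists_inP; exists e; rewrite ?zA.
Qed.

Lemma mem_nbhdD T A z e : z \subset T -> e \in T -> z :\ e \in A ->
  z \in nbhd T A.
Proof.
move=> zT eT zA; rewrite !inE zT /=; apply/orP; right.
by apply/exists_inP; exists e; rewrite ?zA ?orbT.
Qed.

Lemma nbhdS T A B : A \subset B -> nbhd T A \subset nbhd T B.
Proof.
move=> /subsetP AB; apply/subsetP => z; rewrite inE powersetE => /andP[zT].
case/orP => [/AB|/exists_inP[e eT /orP[]/AB]]; first exact: mem_nbhd.
  exact: mem_nbhdU.
exact: mem_nbhdD.
Qed.

(** Initial segments form a chain: a point of [A] outside [B] comes after all of [B], which would
    make [B] a proper subset of [A]. *)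
Lemma initial_subset T A B : initial T A -> initial T B -> #|A| <= #|B| ->
  A \subset B.
Proof.
move=> /initialP[AT iniA] /initialP[BT iniB] AB.
apply/subsetP => x xA; apply: contraLR AB => xB; rewrite -ltnNge.
have xT : x \subset T by have /subsetP/(_ x xA) := AT; rewrite inE.
apply: proper_card; apply/properP; split; last by exists x.
apply/subsetP => y yB; have yT := subsetP BT y yB; rewrite inE in yT.
apply: (iniA y x) => //; apply: contraNT xB; rewrite -ltnNge => /ltnW.
exact: iniB.
Qed.

Lemma initial_below T m : initial T [set z in powerset T | key z <= m].
Proof.
apply/initialP; split; first by apply/subsetP => z; rewrite inE => /andP[].
by move=> x y xT; rewrite !inE xT => /andP[_ ym] /leq_trans->.
Qed.

Lemma initial_ex T m : m <= 2 ^ #|T| -> exists2 B, initial T B & #|B| = m.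
Proof.
elim: m => [_|m IH mT].
  exists set0; rewrite ?cards0 //; apply/initialP; split; first exact: sub0set.
  by move=> x y _; rewrite inE.
have [B /initialP[BT ini] Bm] := IH (ltnW mT).
have [x0 x0P] : exists x0, x0 \in powerset T :\: B.
  by apply/set0Pn; rewrite -card_gt0 cardsD (setIidPr BT) card_powerset Bm subn_gt0.
have [x] := arg_minnP (P := mem (powerset T :\: B)) (@key n) x0P.
rewrite !inE => /andP[xB xT] xmin; exists (x |: B); last by rewrite cardsU1 xB Bm.
apply/initialP; split; first by rewrite subUset sub1set inE xT.
move=> y z yT; rewrite !inE => /orP[/eqP->|zB] yz; last first.
  by rewrite (ini y z) ?orbT.
case yB: (y \in B); rewrite ?orbT ?orbF //.
apply/eqP/key_inj/eqP; rewrite eqn_leq yz; apply: xmin.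
by rewrite !inE yB.
Qed.

(** Among the neighbours of [x], [dropmax x] has the smallest key, so membership in an initial
    segment need only be tested there. *)
Lemma nbhd_initialE T B x : initial T B -> B != set0 -> x \subset T ->
  (x \in nbhd T B) = (x == set0) || (dropmax x \in B).
Proof.
move=> /initialP[BT ini] /set0Pn[b bB] xT.
have drop y : y \in B -> y != set0 -> dropmax y \in B.
  move=> yB y0; apply: (ini _ y) => //; last exact/ltnW/key_dropmax_lt.
  have := subsetP BT y yB; rewrite inE; apply: subset_trans.
  by apply/subsetP => e; rewrite inE => /andP[].
have [->|x0] := eqVneq x set0.
  apply: mem_nbhd; rewrite ?sub0set //; apply: (ini _ b); rewrite ?sub0set //.
  by rewrite /key big_set0.
have [m [mx mmax Dx]] := dropmaxP x0.
apply/idP/idP => /= [|DB]; last first.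
  by apply: (@mem_nbhdD T B x m); rewrite -?Dx // (subsetP xT).
rewrite inE => /andP[_ /orP[xB|/exists_inP[e eT]]]; first exact: drop.
have [ex|ex] := boolP (e \in x).
  rewrite (setUidPr _) ?sub1set // => /orP[xB|xB]; first exact: drop.
  apply: (ini _ _ _ xB); last exact: key_dropmax_min.
  by rewrite Dx; apply: subset_trans xT; apply: subD1set.
case/orP => xB; apply: drop => //; last first.
  suff <- : x :\ e = x by [].
  by apply/setDidPl; rewrite disjoint_sym disjoints1.
by apply: (ini _ _ xT xB); rewrite keyU1 // leq_addl.
Qed.

Lemma nbhd_initial T B : initial T B -> initial T (nbhd T B).
Proof.
move=> iniB; apply/initialP; split; first exact: nbhd_sub.
have [->|B0] := eqVneq B set0.
  move=> x y _; rewrite !inE => /andP[_ /exists_inP[e _]].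
  by rewrite !inE.
move=> x y xT yN xy; have yT := subsetP (nbhd_sub _ _) y yN.
rewrite inE in yT; move: yN; rewrite !(nbhd_initialE iniB B0) //.
have [//|x0] := eqVneq x set0.
have [y0|y0] := eqVneq y set0 => /=.
  move: xy; rewrite y0 leqNgt key_card //.
  by rewrite cards0 card_gt0.
case/initialP: iniB => BT ini yB; apply: (ini _ _ _ yB).
  have [m [mx mmax ->]] := dropmaxP x0.
  by apply: subset_trans xT; apply: subD1set.
exact: dropmax_mono.
Qed.

(** [A :\: B] and [B :\: A] have the same nonzero size, and every key in the first exceeds every key
    in the second. This makes the sum of keys a termination measure for compression. *)
Lemma sum_key_initial T A B : initial T B -> A \subset powerset T ->
  #|A| = #|B| -> A != B -> \sum_(x in B) key x < \sum_(x in A) key x.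
Proof.
move=> /initialP[BT ini] /subsetP AT AB neAB.
have cAB := cardsID B A; have cBA := cardsID A B.
rewrite setIC in cBA.
have /set0Pn[b0 b0P] : B :\: A != set0.
  rewrite -card_gt0 lt0n; apply: contra neAB => /eqP c0.
  rewrite eq_sym eqEcard AB leqnn andbT.
  by rewrite -setD_eq0 -cards_eq0 c0.
have [c] := arg_maxnP (P := mem (B :\: A)) (@key n) b0P.
rewrite /= => cBA' cmax.
rewrite (big_setID A) [ltnRHS](big_setID B) /= setIC ltn_add2l.
apply: (@leq_ltn_trans (\sum_(x in B :\: A) key c)).
  by apply: leq_sum => x xP; apply: cmax.
apply: (@leq_trans (\sum_(x in A :\: B) (key c).+1)); last first.
  apply: leq_sum => x; rewrite inE => /andP[xB xA]; rewrite ltnNge.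
  apply: contra xB; apply: ini; first by have := AT x xA; rewrite inE.
  by move: cBA'; rewrite inE => /andP[].
have c0 : 0 < #|B :\: A| by apply/card_gt0P; exists b0.
rewrite !sum_nat_const; nia.
Qed.

End Neighbourhood.

(** * Compression and Harper's theorem *)

Section Compression.
Variable n : nat.
Implicit Types (x y z T : {set 'I_n}) (A B C : {set {set 'I_n}}) (i : 'I_n).

Definition sec0 i T A : {set {set 'I_n}} := A :&: powerset (T :\ i).
Definition sec1 i T A : {set {set 'I_n}} :=
  [set z in powerset (T :\ i) | i |: z \in A].

Lemma setU1_notin_inj i x y : i \notin x -> i \notin y ->
  i |: x = i |: y -> x = y.
Proof. by move=> ix iy E; rewrite -(setU1K ix) E setU1K. Qed.

Lemma notin_subD1 i T z : z \subset T :\ i -> i \notin z.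
Proof. by rewrite subsetD1 => /andP[]. Qed.

Lemma subD1_sub i T z : z \subset T :\ i -> z \subset T.
Proof. by rewrite subsetD1 => /andP[]. Qed.

Lemma setU1_subE i T z : i \in T -> (i |: z \subset T) = (z \subset T).
Proof. by move=> iT; rewrite subUset sub1set iT. Qed.

Lemma big_sections i T A (F : {set 'I_n} -> nat) : A \subset powerset T ->
  \sum_(x in A) F x =
  \sum_(x in sec0 i T A) F x + \sum_(x in sec1 i T A) F (i |: x).
Proof.
move=> /subsetP AT; rewrite (bigID (fun x : {set 'I_n} => i \in x)) /= addnC.
congr (_ + _).
  apply: eq_bigl => x; rewrite !inE subsetD1.
  by case xA: (x \in A) => //=; have := AT x xA; rewrite inE => ->.
rewrite (reindex_onto (fun x => i |: x) (fun x => x :\ i)) /=; last first.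
  by move=> x /andP[_ ix]; rewrite setD1K.
apply: eq_bigl => x; rewrite !inE eqxx andbT subsetD1.
case xA: (i |: x \in A); rewrite ?andbF //= andbT.
have := AT _ xA; rewrite inE subUset => /andP[_ ->] /=.
apply/eqP/idP => [<-|ix]; first by rewrite !inE eqxx.
by rewrite setU1K.
Qed.

Lemma card_sections i T A : A \subset powerset T ->
  #|A| = #|sec0 i T A| + #|sec1 i T A|.
Proof. by move=> AT; rewrite -!sum1_card (big_sections i _ AT). Qed.

Lemma sum_key_sections i T A : A \subset powerset T ->
  \sum_(x in A) key x = \sum_(x in sec0 i T A) key x +
    \sum_(x in sec1 i T A) key x + #|sec1 i T A| * (2 ^ n - 2 ^ (n - i.+1)).
Proof.
move=> AT; rewrite (big_sections i _ AT) -addnA; congr (_ + _).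
rewrite -sum_nat_const -big_split /=; apply: eq_bigr => x.
by rewrite inE powersetE => /andP[/notin_subD1 ix _]; rewrite keyU1 // addnC.
Qed.

(** Flipping a coordinate other than [i] stays within a section, while flipping [i] exchanges the
    two sections. *)
Lemma sec0_nbhd i T A : i \in T ->
  sec0 i T (nbhd T A) = nbhd (T :\ i) (sec0 i T A) :|: sec1 i T A.
Proof.
move=> iT; apply/setP => z; rewrite !inE.
have [zT|zT] := boolP (z \subset T :\ i); rewrite ?andbF //= ?andbT.
have iz := notin_subD1 zT; have zT' := subD1_sub zT; rewrite zT' /=.
have ziE : z :\ i = z by apply/setDidPl; rewrite disjoint_sym disjoints1.
case zA: (z \in A) => //=.
apply/exists_inP/orP => [[e eT]|[/exists_inP[e]|iA]].
- have [->|ei] := eqVneq e i; first by rewrite ziE zA orbF; right.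
  have eTi : e \in T :\ i by rewrite !inE ei.
  case/orP => E; left; apply/exists_inP; exists e => //; rewrite !inE E /=.
    by rewrite setU1_subE // zT.
  by rewrite (subset_trans (subD1set _ _) zT) orbT.
- rewrite inE => /andP[ei eT]; rewrite !inE => E; exists e => //.
  by case/orP: E => /andP[-> _]; rewrite ?orbT.
- by exists i => //; rewrite iA.
Qed.

Lemma sec1_nbhd i T A : i \in T ->
  sec1 i T (nbhd T A) = nbhd (T :\ i) (sec1 i T A) :|: sec0 i T A.
Proof.
move=> iT; apply/setP => z; rewrite !inE.
have [zT|zT] := boolP (z \subset T :\ i); rewrite ?andbF //= ?andbT.
have iz := notin_subD1 zT; have zT' := subD1_sub zT.
rewrite setU1_subE // zT' /=.
case zA: (i |: z \in A) => //=.
apply/exists_inP/orP => [[e eT]|[/exists_inP[e]|iA]].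
- have [->|ei] := eqVneq e i; first by rewrite setUA setUid zA setU1K //; right.
  have eTi : e \in T :\ i by rewrite !inE ei.
  case/orP => E; left; apply/exists_inP; exists e => //; rewrite !inE.
    by rewrite setU1_subE // zT setUCA E.
  rewrite (subset_trans (subD1set _ _) zT) /=.
  suff -> : i |: z :\ e = (i |: z) :\ e by rewrite E orbT.
  rewrite setDUl; congr (_ :|: _); apply/esym/setDidPl.
  by rewrite disjoint_sym disjoints1 inE.
- rewrite inE => /andP[ei eT]; rewrite !inE => E; exists e => //.
  case/orP: E => /andP[_]; first by rewrite setUCA => ->.
  suff -> : i |: z :\ e = (i |: z) :\ e by move=> ->; rewrite orbT.
  rewrite setDUl; congr (_ :|: _); apply/esym/setDidPl.
  by rewrite disjoint_sym disjoints1.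
- by exists i => //; rewrite setU1K // iA orbT.
Qed.

(** Nestedness turns the unions in [sec0_nbhd] and [sec1_nbhd] into maxima for a compressed set,
    whereas for a general set the maximum is only a lower bound. *)
Lemma initial_setU T A B : initial T A -> initial T B ->
  #|A :|: B| = maxn #|A| #|B|.
Proof.
move=> iA iB; have [AB|/ltnW BA] := leqP #|A| #|B|.
  by rewrite (setUidPr _) //; apply: (initial_subset iA iB AB).
by rewrite (setUidPl _) //; apply: (initial_subset iB iA BA).
Qed.

Definition glue i B0 B1 : {set {set 'I_n}} :=
  B0 :|: [set i |: z | z in B1].

Lemma sec0_glue i T B0 B1 : B0 \subset powerset (T :\ i) ->
  sec0 i T (glue i B0 B1) = B0.
Proof.
move=> /subsetP BT; apply/setP => z; rewrite !inE.
case zB: (z \in B0) => /=; first by have := BT z zB; rewrite inE.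
apply/andP => -[/imsetP[w _ ->]]; rewrite subsetD1 => /andP[_].
by rewrite !inE eqxx.
Qed.

Lemma sec1_glue i T B0 B1 : B0 \subset powerset (T :\ i) ->
  B1 \subset powerset (T :\ i) -> sec1 i T (glue i B0 B1) = B1.
Proof.
move=> /subsetP B0T /subsetP B1T; apply/setP => z; rewrite !inE.
apply/andP/idP => [[zT /orP[/B0T|/imsetP[w wB E]]]|zB].
- by rewrite powersetE => /notin_subD1; rewrite !inE eqxx.
- have := B1T w wB; rewrite powersetE => wT.
  by rewrite (setU1_notin_inj (notin_subD1 zT) (notin_subD1 wT) E).
- by have := B1T z zB; rewrite powersetE => ->; rewrite imset_f ?orbT.
Qed.

Lemma glue_sub i T B0 B1 : i \in T -> B0 \subset powerset (T :\ i) ->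
  B1 \subset powerset (T :\ i) -> glue i B0 B1 \subset powerset T.
Proof.
move=> iT /subsetP B0T /subsetP B1T; apply/subsetP => z; rewrite !inE.
case/orP => [/B0T|/imsetP[w /B1T + ->]]; rewrite powersetE => /subD1_sub //.
by rewrite setU1_subE.
Qed.

Lemma sub_sec0 i T A : sec0 i T A \subset powerset (T :\ i).
Proof. exact: subsetIr. Qed.

Lemma sub_sec1 i T A : sec1 i T A \subset powerset (T :\ i).
Proof. by apply/subsetP => z; rewrite inE => /andP[]. Qed.

(** Both sections are replaced by initial segments of the same sizes. Each term of the resulting
    maxima is bounded through the theorem in the smaller subcube, and the sum of keys drops because
    at least one section changes. *)
Lemma compression i T A : i \in T -> A \subset powerset T ->
  (forall C D, C \subset powerset (T :\ i) -> initial (T :\ i) D ->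
     #|D| = #|C| -> #|nbhd (T :\ i) D| <= #|nbhd (T :\ i) C|) ->
  ~~ (initial (T :\ i) (sec0 i T A) && initial (T :\ i) (sec1 i T A)) ->
  exists C, [/\ C \subset powerset T, #|C| = #|A|,
    #|nbhd T C| <= #|nbhd T A| & \sum_(x in C) key x < \sum_(x in A) key x].
Proof.
move=> iT AT harper notini.
have [B0 iB0 cB0] : exists2 B, initial (T :\ i) B & #|B| = #|sec0 i T A|.
  by apply: initial_ex; rewrite -card_powerset subset_leq_card ?sub_sec0.
have [B1 iB1 cB1] : exists2 B, initial (T :\ i) B & #|B| = #|sec1 i T A|.
  by apply: initial_ex; rewrite -card_powerset subset_leq_card ?sub_sec1.
have /initialP[B0T _] := iB0; have /initialP[B1T _] := iB1.
have CT := glue_sub iT B0T B1T.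
have s0 := sec0_glue B1 B0T; have s1 := sec1_glue B0T B1T.
exists (glue i B0 B1); split => //.
- by rewrite (card_sections i CT) (card_sections i AT) s0 s1 cB0 cB1.
- rewrite (card_sections i (nbhd_sub _ _)) [leqRHS](card_sections i (nbhd_sub _ _)).
  rewrite !sec0_nbhd // !sec1_nbhd // s0 s1.
  have iN0 := nbhd_initial iB0; have iN1 := nbhd_initial iB1.
  rewrite (initial_setU iN0 iB1) (initial_setU iN1 iB0).
  apply: leq_add; rewrite geq_max; apply/andP; split.
  + apply: leq_trans (subset_leq_card (subsetUl _ _)).
    by apply: harper => //; apply: sub_sec0.
  + by rewrite cB1 (subset_leq_card (subsetUr _ _)).
  + apply: leq_trans (subset_leq_card (subsetUl _ _)).
    by apply: harper => //; apply: sub_sec1.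
  + by rewrite cB0 (subset_leq_card (subsetUr _ _)).
- rewrite (sum_key_sections i CT) (sum_key_sections i AT) s0 s1 cB1 ltn_add2r.
  have lt0 := sum_key_initial iB0 (sub_sec0 i T A) (esym cB0).
  have lt1 := sum_key_initial iB1 (sub_sec1 i T A) (esym cB1).
  have [E0|/lt0 {}lt0] := eqVneq (sec0 i T A) B0;
  have [E1|/lt1 {}lt1] := eqVneq (sec1 i T A) B1.
  + by rewrite E0 E1 iB0 iB1 in notini.
  + by rewrite E0 ltn_add2l.
  + by rewrite E1 ltn_add2r.
  + by rewrite -addSn leq_add // ltnW.
Qed.

(** If [A] is not initial, it is the segment [I] ending at [x] with [x] replaced by its successor
    [y]. Then [B] is contained in [I] by size, and it remains to show that the neighbourhood of [I]
    lies in that of [A]. *)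
Lemma nbhd_compressed T A B : A \subset powerset T -> initial T B ->
  #|B| = #|A| ->
  {in T, forall i,
     initial (T :\ i) (sec0 i T A) && initial (T :\ i) (sec1 i T A)} ->
  #|nbhd T B| <= #|nbhd T A|.
Proof.
move=> AT iB cBA comp.
(* If [x] and [y] agreed at some [i] of [T], both would belong to the same section at [i];
   cancelling [i] preserves their order, so initiality of that section would put [x] in [A]. *)
have compl x y : x \subset T -> y \in A -> x \notin A -> key x <= key y ->
    y = T :\: x.
  move=> xT yA xA xy; have yT := subsetP AT y yA; rewrite inE in yT.
  apply/setP => i; rewrite inE.
  case iT: (i \in T); last first.
    by rewrite andbF; apply: contraFF iT; apply: (subsetP yT).
  rewrite andbT; have /andP[/initialP[_ i0] /initialP[_ i1]] := comp i iT.
  have D1T z : z \subset T -> z :\ i \subset T :\ i by apply: setSD.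
  case ix: (i \in x); case iy: (i \in y) => //=.
    suff : x :\ i \in sec1 i T A.
      by rewrite inE => /andP[_]; rewrite setD1K // (negbTE xA).
    apply: (i1 _ (y :\ i)); first exact: D1T.
      by rewrite !inE D1T // setD1K.
    by rewrite -(@key_cancel _ i) ?setD1K // !inE eqxx.
  suff : x \in sec0 i T A by rewrite inE (negbTE xA).
  apply: (i0 _ y) => //; first by rewrite subsetD1 xT ix.
  by rewrite !inE yA subsetD1 yT iy.
have [iA|notini] := boolP (initial T A).
  by apply/subset_leq_card/nbhdS/(initial_subset iB iA); rewrite cBA.
have [x [y [xT yA xA xy]]] : exists x y,
    [/\ x \subset T, y \in A, x \notin A & key x <= key y].
  move: notini; rewrite negb_and AT /= => /forall_inPn[x].
  rewrite powersetE => xT /forall_inPn[y yA]; rewrite negb_imply => /andP[xy xA].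
  by exists x, y.
have yC := compl x y xT yA xA xy.
have yT : y \subset T by rewrite yC subsetDl.
have neyx : y != x by apply: contraNneq xA => <-.
have ltxy : key x < key y.
  by rewrite ltn_neqAle xy andbT; apply: contraNneq neyx => /key_inj->.
have CC z : z \subset T -> T :\: (T :\: z) = z.
  by move=> zT; rewrite setDDr setDv set0U; apply/setIidPr.
pose I := [set z in powerset T | key z <= key x].
have iI : initial T I := initial_below T (key x).
have xI : x \in I by rewrite !inE xT leqnn.
have AE : A = y |: (I :\ x).
  apply/setP => z; rewrite !inE.
  have [->|zy] /= := eqVneq z y; first by rewrite yA.
  apply/idP/and3P => [zA|[zx zT lezx]].
    have zT := subsetP AT z zA; rewrite inE in zT.
    split => //; first by apply: contraNneq xA => <-.
    rewrite leqNgt; apply: contra zy => /ltnW xz.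
    by rewrite yC -(compl x z).
  apply: contraT => zA; move: zx; rewrite -(CC z zT) -(compl z y) //.
    by rewrite yC CC ?eqxx.
  exact: leq_trans lezx xy.
have BI : B \subset I.
  apply: initial_subset iB iI _; rewrite cBA AE cardsU1 !inE.
  by rewrite yT [key y <= _]leqNgt ltxy andbF /= (cardsD1 x I) xI.
have nobetween (w : {set 'I_n}) : w \subset T -> key x < key w -> key y <= key w.
  move=> wT xw; rewrite leqNgt; apply/negP => wy.
  have wA : w \notin A.
    rewrite AE !inE negb_or; apply/andP; split.
      by apply: contraTneq wy => ->; rewrite ltnn.
    by rewrite [key w <= _]leqNgt xw !andbF.
  have yw := compl w y wT yA wA (ltnW wy).
  by move: xw; rewrite -(CC x xT) -yC yw CC // ltnn.
have IxA (z : {set 'I_n}) : z \in I -> z != x -> z \in A.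
  by move=> zI zx; rewrite AE !inE zx /=; move: zI; rewrite !inE => ->; rewrite orbT.
apply/subset_leq_card/(subset_trans (nbhdS T BI))/subsetP => z zN.
have zT := subsetP (nbhd_sub _ _) z zN; rewrite inE in zT.
have I0 : I != set0 by apply/set0Pn; exists x.
(* Here [y] is all of [T] and directly follows the empty set, so [T] is a singleton and the
   neighbourhood of [y] is the whole subcube. *)
have [x0|x0] := eqVneq x set0.
  rewrite x0 setD0 in yC.
  have [e eT] : exists e, e \in T.
    by apply/set0Pn; rewrite -yC -x0.
  have key1 : key x < key [set e].
    by apply: key_card; rewrite x0 cards0 cards1.
  have T1 : T = [set e].
    apply/esym/eqP; rewrite eqEcard sub1set eT leqNgt; apply/negP => /key_card.
    by rewrite -yC ltnNge nobetween // sub1set.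
  move: zT; rewrite T1 subset1 -T1 => /orP[/eqP->|/eqP->].
    by apply: mem_nbhd => //; rewrite T1 -T1 -yC.
  by apply: (@mem_nbhdU _ _ _ _ e); rewrite ?sub0set // setU0 -T1 -yC.
move: zN; rewrite (nbhd_initialE iI I0) //.
have [-> _|z0] := eqVneq z set0.
  apply: mem_nbhd; rewrite ?sub0set //; apply: IxA; last by rewrite eq_sym.
  by rewrite !inE sub0set /key big_set0.
have [m [mz mmax Dz]] := dropmaxP z0; rewrite Dz /= => DI.
have mT := subsetP zT m mz.
have [Dx|Dx] := eqVneq (z :\ m) x; last first.
  by apply: (@mem_nbhdD _ _ _ _ m) => //; apply: IxA.
(* Remaining case: [z] is [x] with a new maximum [m]. It turns out that [x] is [[set k]] and [y] is
   [[set m]], so that deleting [k] from [z] reaches [y]. *)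
have mx : m \notin x by rewrite -Dx !inE eqxx.
have [k [kx kmax _]] := dropmaxP x0.
have km : k < m.
  rewrite ltn_neqAle mmax; last by move: kx; rewrite -Dx => /setD1P[].
  by rewrite andbT; apply: contraNneq mx => /ord_inj<-.
have kT := subsetP xT k kx.
pose w := m |: x :\ k.
have mxk : m \notin x :\ k by rewrite !inE negb_and mx orbT.
have cw : #|w| = #|x| by rewrite cardsU1 mxk (cardsD1 k x) kx.
have wT : w \subset T.
  by rewrite setU1_subE //; apply: subset_trans xT; apply: subD1set.
have ltxw : key x < key w.
  rewrite keyU1 // (keyD1 kx) ltn_add2r ltn_sub2l //.
    by apply: leq_trans (_ : 2 ^ (n - k.+1) <= _);
      rewrite ?leq_exp2l ?leq_subr // ltn_exp2l // ltn_sub2l ?ltnS // (leq_ltn_trans km).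
  by rewrite ltn_exp2l // ltn_sub2l ?ltnS // (leq_ltn_trans km).
have leyw := nobetween w wT ltxw.
have cyx : #|y| = #|x|.
  case: (ltngtP #|y| #|x|) => [/key_card|yx|//]; first by rewrite ltnNge xy.
  by move: leyw; rewrite leqNgt key_card // cw.
(* Otherwise w, of the same size as x, would lie strictly between x and its
   successor y. *)
suff xk : x :\ k = set0.
  have wE : w = [set m] by rewrite /w xk setU0.
  have yE : y = [set m].
    have cy : #|y| == 1 by rewrite cyx -cw wE cards1.
    case/cards1P: cy => j yj.
    suff : m \in y by rewrite yj inE => /eqP->.
    by rewrite yC inE mx mT.
  apply: (@mem_nbhdD _ _ _ _ k) => //.
  suff -> : z :\ k = y by [].
  rewrite yE -(setD1K mz) Dx setDUl xk setU0; apply/setDidPl.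
  by rewrite disjoints1 inE -val_eqE neq_ltn km orbT.
apply/eqP; apply: contraLR leyw => /set0Pn[e]; rewrite !inE => /andP[ek ex].
rewrite -ltnNge; apply: key_lex; first by rewrite cw cyx.
have : lex_lt x y.
  by move: xy; rewrite leq_key cyx ltnn eqxx eq_sym (negbTE neyx).
case/existsP => i /andP[]; rewrite inE => /andP[iy ix] /forallP agree.
(* Complements in [T] disagree at every point of [T], so their first difference [i] is the least
   element of [T]. *)
have Tge (j : 'I_n) : j \in T -> i <= j.
  move=> jT; rewrite leqNgt; apply/negP => ji; have := agree j.
  by rewrite ji yC inE jT andbT; case: (j \in x).
have ik : i != k.
  apply: contraNneq ek => ik; rewrite -val_eqE eqn_leq kmax //= -ik.
  by apply: Tge; apply: (subsetP xT).
apply/existsP; exists i; rewrite !inE iy ik ix orbT /=.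
apply/forallP => j; apply/implyP => ji.
have jT : j \notin T by apply: contraL ji => /Tge; rewrite leqNgt.
have -> : j \in y = false by apply: contraNF jT; apply: (subsetP yT).
by apply/eqP; apply: contraNF jT; apply: (subsetP wT).
Qed.

(** Outer induction on the dimension [#|T|], which supplies the sections, and inner induction on the
    sum of keys, which compression lowers until the set is fully compressed. *)
Theorem harper T A B : A \subset powerset T -> initial T B -> #|B| = #|A| ->
  #|nbhd T B| <= #|nbhd T A|.
Proof.
have [t] := ubnP #|T|; elim: t => // t IHt in T A B *; rewrite ltnS => Tt.
have [s] := ubnP (\sum_(x in A) key x).
elim: s => // s IHs in A B *; rewrite ltnS => As AT iB BA.
have [/forall_inP comp|/forall_inPn[i iT notini]] := boolP [forall i in T,
    initial (T :\ i) (sec0 i T A) && initial (T :\ i) (sec1 i T A)].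
  exact: nbhd_compressed.
have [C [CT CA NC sC]] : exists C, [/\ C \subset powerset T, #|C| = #|A|,
    #|nbhd T C| <= #|nbhd T A| & \sum_(x in C) key x < \sum_(x in A) key x].
  apply: (compression iT AT _ notini) => C D; apply: IHt.
  by apply: leq_trans Tt; rewrite [ltnRHS](cardsD1 i) iT.
apply: leq_trans NC; apply: IHs => //; last by rewrite CA.
exact: leq_trans sC As.
Qed.

End Compression.

(** * Enlargements in the cube *)

Section Enlarge.
Variable n : nat.
Implicit Types (S T z : {set 'I_n}) (A B : {set {set 'I_n}}) (x y : cube n).

Lemma support_set_inj : injective (@support_set n).
Proof.
by move=> x y /setP E; apply/ffunP => i; have := E i; rewrite !inE.
Qed.

Lemma simplicial_leE x y :
  simplicial_le x y = (key (support_set x) <= key (support_set y)).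
Proof. by rewrite leq_key /simplicial_le (inj_eq support_set_inj). Qed.

Definition dist S T : nat := \sum_(i < n) ((i \in S) (+) (i \in T)).

Lemma hamming_dist x y : hamming x y = dist (support_set x) (support_set y).
Proof.
by apply: eq_bigr => i _; rewrite !inE; case: (x i); case: (y i).
Qed.

Lemma dist_eq0 S T : (dist S T == 0) = (S == T).
Proof.
rewrite sum_nat_eq0; apply/forallP/eqP => [E|-> i]; last by rewrite addbb.
by apply/setP => i; have := E i; do 2!case: (i \in _).
Qed.

Lemma dist_split S T e :
  dist S T = ((e \in S) (+) (e \in T)) + dist (S :\ e) (T :\ e).
Proof.
rewrite /dist (bigD1 e) //= [in RHS](bigD1 e) //= !inE eqxx add0n; congr (_ + _).
by apply: eq_bigr => i ie; rewrite !inE ie.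
Qed.

Lemma iter_nbhd k A z : (z \in iter k (nbhd [set: 'I_n]) A) =
  [exists S in A, dist z S <= k].
Proof.
elim: k => [|k IH] in z *.
  apply/idP/exists_inP => [zA|[S SA]]; first by exists z; rewrite // leqn0 dist_eq0.
  by rewrite leqn0 dist_eq0 => /eqP->.
rewrite iterS; apply/idP/exists_inP => [|[S SA]].
  (* [z'] agrees with [z] except possibly at [e], so passing between them costs at most one unit of
     distance. *)
  have IHe z' e : z' :\ e = z :\ e -> z' \in iter k (nbhd [set: 'I_n]) A ->
      exists2 S, S \in A & dist z S <= k.+1.
    move=> E; rewrite IH => /exists_inP[S SA zS]; exists S => //.
    move: zS; rewrite (dist_split z' S e) (dist_split z S e) E.
    by move: (dist _ _) => d; do 3!case: (e \in _); rewrite /= ?addSn ?ltnS; lia.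
  rewrite inE => /andP[_ /orP[|/exists_inP[e _ /orP[]]]].
  - rewrite IH => /exists_inP[S SA zS]; exists S => //; exact: leqW.
  - by apply: (IHe _ e); rewrite setDUl setDv set0U.
  - by apply: (IHe _ e); rewrite setDDl setUid.
have [<-|] := eqVneq S z.
  move=> _; apply: mem_nbhd => //; rewrite IH; apply/exists_inP; exists S => //.
  by have /eqP-> : dist S S == 0 by rewrite dist_eq0.
rewrite eq_sym.
move=> zS; have [e ne] : exists e, (e \in z) != (e \in S).
  apply/existsP; rewrite -negb_forall; apply: contra zS => /forallP E.
  by apply/eqP/setP => e; apply/eqP.
rewrite (dist_split z S e).
case ez: (e \in z) ne => ne le.
  apply: (@mem_nbhdD _ _ _ _ e) => //; rewrite IH; apply/exists_inP; exists S => //.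
  rewrite (dist_split _ S e) setDDl setUid !inE eqxx.
  by move: le; case: (e \in S) ne.
apply: (@mem_nbhdU _ _ _ _ e) => //; rewrite IH; apply/exists_inP; exists S => //.
rewrite (dist_split _ S e) setDUl setDv set0U !inE eqxx.
by move: le; case: (e \in S) ne.
Qed.

Lemma support_enlarge (A : {set cube n}) k :
  @support_set n @: enlarge A k = iter k (nbhd [set: 'I_n]) (@support_set n @: A).
Proof.
apply/setP => z; rewrite iter_nbhd; apply/imsetP/exists_inP.
  case=> x; rewrite inE => /exists_inP[y yA xy] ->.
  by exists (support_set y); rewrite ?imset_f // -hamming_dist.
case=> _ /imsetP[y yA ->] zy; have E : z = support_set [ffun i => i \in z].
  by apply/setP => i; rewrite inE ffunE.
exists [ffun i => i \in z] => //; rewrite inE; apply/exists_inP; exists y => //.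
by rewrite hamming_dist -E.
Qed.

Lemma card_enlarge (A : {set cube n}) k :
  #|enlarge A k| = #|iter k (nbhd [set: 'I_n]) (@support_set n @: A)|.
Proof. by rewrite -support_enlarge card_imset //; exact: support_set_inj. Qed.

(** After [k] steps the two neighbourhoods may differ in size, so [harper] does not apply to them
    directly. It is applied to an initial segment [D] as large as the one of [A], which contains the
    one of [B]. *)
Lemma harper_iter A B k : initial setT B -> #|B| = #|A| ->
  initial setT (iter k (nbhd setT) B) /\
  #|iter k (nbhd setT) B| <= #|iter k (nbhd setT) A|.
Proof.
move=> iB cBA; elim: k => [|k [iBk le]]; first by rewrite /= cBA.
rewrite !iterS; split; first exact: nbhd_initial.
have subT (C : {set {set 'I_n}}) : C \subset powerset setT.
  by apply/subsetP => z _; rewrite inE subsetT.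
have [D iD cD] : exists2 D, initial [set: 'I_n] D & #|D| = #|iter k (nbhd setT) A|.
  by apply: initial_ex; rewrite -card_powerset subset_leq_card.
apply: leq_trans (harper (subT _) iD cD).
by apply/subset_leq_card/nbhdS/(initial_subset iBk iD); rewrite cD.
Qed.

Let s := sort (@simplicial_le n) (enum {: cube n}).

Lemma card_cube : #|{: cube n}| = 2 ^ n.
Proof. by rewrite card_ffun card_bool card_ord. Qed.

Lemma card_initial_segment m : m <= 2 ^ n -> #|initial_segment n m| = m.
Proof.
move=> m2; rewrite cardsE; have /card_uniqP -> : uniq (take m s).
  by rewrite take_uniq // sort_uniq enum_uniq.
by rewrite size_takel // size_sort -cardE card_cube.
Qed.

(** A point left out of the first [m] entries of the sorted list comes after all of them, so
    antisymmetry rules out its preceding one of them. *)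
Lemma initial_segment_initial m : initial setT (@support_set n @: initial_segment n m).
Proof.
apply/initialP; split; first by apply/subsetP => z _; rewrite inE subsetT.
move=> z _ _ /imsetP[y + ->] le; rewrite inE => ym.
have E : z = support_set [ffun i => i \in z].
  by apply/setP => i; rewrite inE ffunE.
rewrite E; apply: imset_f; rewrite inE.
set x := finfun _ in E *; rewrite E -simplicial_leE in le.
have : x \in take m s ++ drop m s by rewrite cat_take_drop mem_sort mem_enum.
rewrite mem_cat => /orP[//|xm].
have tot : total (@simplicial_le n).
  by move=> a b; rewrite !simplicial_leE leq_total.
have tr : transitive (@simplicial_le n).
  by move=> a b c; rewrite !simplicial_leE; apply: leq_trans.
have : pairwise (@simplicial_le n) (take m s ++ drop m s).
  by rewrite cat_take_drop -sorted_pairwise // sort_sorted.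
rewrite pairwise_cat; case/and3P=> /allrelP/(_ y x ym xm) yx _ _.
suff -> : x = y by [].
apply/support_set_inj/key_inj/eqP.
by rewrite eqn_leq -!simplicial_leE le yx.
Qed.

Theorem harper_enlarge (A : {set cube n}) k :
  #|enlarge (initial_segment n #|A|) k| <= #|enlarge A k|.
Proof.
rewrite !card_enlarge; have iI := initial_segment_initial #|A|.
apply: (proj2 (harper_iter k iI _)).
rewrite !(card_imset _ (@support_set_inj)).
by rewrite card_initial_segment // -card_cube max_card.
Qed.

Lemma enlargeS (A : {set cube n}) k l : k <= l ->
  enlarge A k \subset enlarge A l.
Proof.
move=> kl; apply/subsetP => x; rewrite !inE => /exists_inP[y yA xy].
by apply/exists_inP; exists y => //; apply: leq_trans kl.
Qed.

End Enlarge.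

Import Order.TTheory GRing.Theory Num.Theory.

Local Open Scope ring_scope.

(** * A Prekopa-Leindler inequality for level sets *)

(** Cauchy-Schwarz for the vectors with entries the square roots of [s' - s], [s] and of [t' - t],
    [t]. *)
Lemma sqrt_supermul (R : realType) (s s' t t' : R) :
  0 <= s -> s <= s' -> 0 <= t -> t <= t' ->
  Num.sqrt ((s' - s) * (t' - t)) <= Num.sqrt (s' * t') - Num.sqrt (s * t).
Proof.
move=> s0 ss t0 tt; rewrite -subr_ge0 in ss; rewrite -subr_ge0 in tt.
rewrite lerBrDr (sqrtrM _ ss) (sqrtrM _ s0).
rewrite -[leLHS]ger0_norm ?addr_ge0 ?mulr_ge0 ?sqrtr_ge0 // -sqrtr_sqr ler_wsqrtr //.
have := sqr_sqrtr s0; have := sqr_sqrtr t0; have := sqr_sqrtr ss; have := sqr_sqrtr tt.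
move: (Num.sqrt s) (Num.sqrt t) (Num.sqrt (s' - s)) (Num.sqrt (t' - t)).
move=> a b c d hd hc hb ha.
have -> : s' = c ^+ 2 + a ^+ 2 by rewrite hc ha; ring.
have -> : t' = d ^+ 2 + b ^+ 2 by rewrite hd hb; ring.
rewrite -subr_ge0; have := sqr_ge0 (c * b - a * d); congr (0 <= _); ring.
Qed.

Section LayerCake.
Variables (R : realType) (T : finType).
Implicit Types (f : T -> R) (s : R).

Definition level f s : {set T} := [set x | s <= f x].
(** By the layer-cake formula, for nonnegative [f] and [s] this is the integral of [#|level f u|]
    over [u] from 0 to [s]. *)
Definition trunc f s : R := \sum_x Num.min (f x) s.

Lemma trunc0 f : (forall x, 0 <= f x) -> trunc f 0 = 0.
Proof. by move=> f0; apply: big1 => x _; apply: min_r. Qed.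

Lemma trunc_flat f s0 s u : (forall x, f x <= s0 \/ s <= f x) -> s0 < s ->
  s0 <= u <= s -> trunc f u = trunc f s0 + (u - s0) * #|level f s|%:R.
Proof.
move=> gap lt /andP[u0 us]; rewrite mulr_natr -sumr_const big_mkcond -big_split.
apply: eq_bigr => x _; rewrite inE; case: (gap x) => [fs|sf] /=.
  rewrite (lt_geF (le_lt_trans fs lt)) addr0 !min_l //.
  exact: le_trans u0.
by rewrite sf !min_r ?(le_trans us) ?(le_trans (ltW lt)) //; ring.
Qed.

(** [s0] is the largest value of [f] below [s], or 0 if there is none. The last clause feeds the
    induction: 0 is the base case, and a value of [f] lowers [below]. *)
Lemma previous_level f s : (forall x, 0 <= f x) -> 0 < s ->
  exists s0, [/\ 0 <= s0, s0 < s, forall x, f x <= s0 \/ s <= f x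
               & s0 = 0 \/ exists x, f x = s0].
Proof.
move=> f0 s_gt0; have [/existsP[x0 x0s]|/existsPn no] := boolP [exists x, f x < s].
  case: (arg_maxP (P := fun x => f x < s) f x0s) => x xs xmax; exists (f x); split => //.
    by move=> y; case: (ltP (f y) s) => [/xmax|]; [left|right].
  by right; exists x.
exists 0; split => // [x|]; last by left.
by right; rewrite leNgt no.
Qed.

End LayerCake.

(** * The transport argument *)

Section PrekopaLeindler.
Variables (R : realType) (H : R -> R).
Hypothesis H_ge0 : forall r, 0 <= r -> 0 <= H r.

(** A slope bound for [H] in difference form, since the intended [H] is piecewise linear with kinks.
    The level sets are taken at the upper heights, as in [trunc_flat]. *)
Definition level_bound (T : finType) (f g : T -> R) : Prop :=
  forall s s' t t', 0 <= s -> s <= s' -> 0 <= t -> t <= t' ->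
    (Num.sqrt (s' * t') - Num.sqrt (s * t)) *
      Num.sqrt (#|level f s'|%:R * #|level g t'|%:R)
    <= H (Num.sqrt (s' * t')) - H (Num.sqrt (s * t)).

Lemma level_bound_sym (T : finType) (f g : T -> R) :
  level_bound f g -> level_bound g f.
Proof.
move=> b s s' t t' s0 ss t0 tt; have := b _ _ _ _ t0 tt s0 ss.
by rewrite (mulrC t') (mulrC t) [#|level f _|%:R * _]mulrC.
Qed.

Definition below (T : finType) (f : T -> R) (s : R) : nat := #|[set x | f x < s]|.

Lemma below_mono (T : finType) (f : T -> R) (s s' : R) :
  s <= s' -> (below f s <= below f s')%N.
Proof.
move=> ss; apply/subset_leq_card/subsetP => x; rewrite !inE => /lt_le_trans.
exact.
Qed.

Lemma below_lt (T : finType) (f : T -> R) (s : R) x :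
  f x < s -> (below f (f x) < below f s)%N.
Proof.
move=> fs; apply: proper_card; apply/properP; split.
  by apply/subsetP => y; rewrite !inE => /lt_trans; apply.
by exists x; rewrite !inE ?ltxx.
Qed.

(** One step back from the fraction [tau] to the fraction [a] that [f] has at its previous level,
    when [g] has the smaller fraction [b] at its own. In between both truncated sums are linear, so
    [level_bound] controls the increment of [H]. *)
Lemma layer_step (T : finType) (f g : T -> R) (p q : R) (N : nat) (s t tau s0 t0 : R) :
  (forall x, 0 <= f x) -> (forall x, 0 <= g x) -> level_bound f g ->
  0 < p -> 0 < q ->
  (forall s t tau, (below f s + below g t < N)%N -> 0 <= s -> 0 <= t -> 0 <= tau ->
     trunc f s = p * tau -> trunc g t = q * tau ->
     Num.sqrt (p * q) * tau <= H (Num.sqrt (s * t))) ->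
  (below f s + below g t <= N)%N ->
  trunc f s = p * tau -> trunc g t = q * tau ->
  0 <= s0 -> s0 < s -> (forall x, f x <= s0 \/ s <= f x) ->
  (s0 = 0 \/ exists x, f x = s0) ->
  0 <= t0 -> t0 < t -> (forall x, g x <= t0 \/ t <= g x) ->
  trunc g t0 / q <= trunc f s0 / p ->
  Num.sqrt (p * q) * tau <= H (Num.sqrt (s * t)).
Proof.
move=> f0 g0 fg p0 q0 IH cN Es Et s0_ge0 s0s fgap s0v t0_ge0 t0t ggap ba.
set a := trunc f s0 / p in ba; set b := trunc g t0 / q in ba.
have Ea : trunc f s0 = p * a by rewrite /a mulrCA divff ?mulr1 // gt_eqF.
have Eb : trunc g t0 = q * b by rewrite /b mulrCA divff ?mulr1 // gt_eqF.
have fu u := trunc_flat (u := u) fgap s0s; have gu u := trunc_flat (u := u) ggap t0t.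
set L := #|level f s|%:R in fu; set M := #|level g t|%:R in gu.
have L0 : 0 <= L by rewrite ler0n.
have M0 : 0 <= M by rewrite ler0n.
have Ds : p * (tau - a) = (s - s0) * L.
  by rewrite mulrBr -Ea -Es fu ?lexx ?ltW //; ring.
have Dt : q * (tau - b) = (t - t0) * M.
  by rewrite mulrBr -Eb -Et gu ?lexx ?ltW //; ring.
have a_ge0 : 0 <= a.
  apply: divr_ge0; last exact: ltW.
  by apply: sumr_ge0 => x _; rewrite le_min f0.
have a_tau : a <= tau.
  by rewrite -subr_ge0 -(pmulr_rge0 _ p0) Ds mulr_ge0 // subr_ge0 ltW.
(* The height where [trunc g] equals [q * a] is found by linear interpolation between the fractions
   [b] and [tau]. If [tau <= b], all three fractions coincide and [t] itself serves. *)
have [t1 [t01 t1t Et1]] : exists t1, [/\ t0 <= t1, t1 <= t & trunc g t1 = q * a].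
  have [btau|taub] := ltP b tau; last first.
    by exists t; split; rewrite ?lexx ?ltW // Et; congr (q * _); lra.
  have tb : 0 < tau - b by rewrite subr_gt0.
  have r0 : 0 <= (a - b) / (tau - b) by rewrite divr_ge0 ?subr_ge0 // ltW.
  have r1 : (a - b) / (tau - b) <= 1 by rewrite ler_pdivrMr // mul1r lerD2r.
  have h0 : t0 <= t0 + (t - t0) * ((a - b) / (tau - b)).
    by rewrite lerDl mulr_ge0 // subr_ge0 ltW.
  have h1 : t0 + (t - t0) * ((a - b) / (tau - b)) <= t.
    rewrite -lerBrDl ler_piMr // subr_ge0 ltW //.
  exists (t0 + (t - t0) * ((a - b) / (tau - b))); split => //.
  rewrite gu ?h0 ?h1 // Eb [t0 + _]addrC addrK mulrAC -Dt.
  by field; rewrite gt_eqF.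
have Dt1 : q * (tau - a) = (t - t1) * M.
  by rewrite mulrBr -Et1 -Et (gu t) ?lexx ?ltW // (gu t1) ?t01 //; ring.
have IHa : Num.sqrt (p * q) * a <= H (Num.sqrt (s0 * t1)).
  case: s0v => [s00|[x xs0]].
    have -> : a = 0 by rewrite /a s00 trunc0 // mul0r.
    by rewrite mulr0 H_ge0 // sqrtr_ge0.
  apply: IH => //; last by apply: le_trans t01.
  apply: leq_trans cN; rewrite -addSn leq_add //; last exact: below_mono.
  by rewrite -xs0 below_lt // xs0.
have step := fg s0 s t1 t s0_ge0 (ltW s0s) (le_trans t0_ge0 t01) t1t.
rewrite -/L -/M in step.
have := sqrt_supermul s0_ge0 (ltW s0s) (le_trans t0_ge0 t01) t1t.
move=> /(ler_wpM2r (sqrtr_ge0 (L * M))) /le_trans/(_ step).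
rewrite -sqrtrM ?mulr_ge0 ?subr_ge0 // ?(ltW s0s) //.
(* By [Ds] and [Dt1] the product is a square up to the factor [p * q], so its root is exactly the
   increment from [a] to [tau]. *)
have -> : (s - s0) * (t - t1) * (L * M) = p * q * (tau - a) ^+ 2.
  by rewrite mulrACA -Ds -Dt1; ring.
rewrite (sqrtrM _ (mulr_ge0 (ltW p0) (ltW q0))) sqrtr_sqr ger0_norm ?subr_ge0 //.
by rewrite mulrBr; lra.
Qed.

(* The heights s and t are moved along so that both truncated sums are the same
   fraction tau of p and q (a transport map); the induction is on the number of
   values of f and g below them. *)
Lemma layer_transport (T : finType) (f g : T -> R) (p q : R) (N : nat) (s t tau : R) :
  (forall x, 0 <= f x) -> (forall x, 0 <= g x) -> level_bound f g ->
  0 < p -> 0 < q ->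
  (below f s + below g t < N)%N -> 0 <= s -> 0 <= t -> 0 <= tau ->
  trunc f s = p * tau -> trunc g t = q * tau ->
  Num.sqrt (p * q) * tau <= H (Num.sqrt (s * t)).
Proof.
move=> f0 g0 fg p0 q0.
elim: N s t tau => // N IH s t tau cN; rewrite ltnS in cN.
have base c r : 0 < c -> 0 = c * tau -> Num.sqrt (p * q) * tau <= H (Num.sqrt r).
  move=> c0 /esym/eqP; rewrite mulf_eq0 (gt_eqF c0) => /eqP->.
  by rewrite mulr0 H_ge0 // sqrtr_ge0.
rewrite le_eqVlt => /predU1P[<- _ _|s_gt0].
  by rewrite trunc0 // => Es _; apply: base Es.
rewrite le_eqVlt => /predU1P[<- _ _|t_gt0 tau0 Es Et].
  by rewrite trunc0 // => Et; apply: base Et.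
have [s0 [s0_ge0 s0s fgap s0v]] := previous_level f0 s_gt0.
have [t0 [t0_ge0 t0t ggap t0v]] := previous_level g0 t_gt0.
have [ba|/ltW ab] := leP (trunc g t0 / q) (trunc f s0 / p).
  exact: (layer_step f0 g0 fg p0 q0 IH cN Es Et s0_ge0 s0s fgap s0v t0_ge0 t0t).
rewrite mulrC [p * q]mulrC [s * t]mulrC mulrC.
apply: (layer_step (N := N) g0 f0 (level_bound_sym fg) q0 p0 _ _ Et Es
  t0_ge0 t0t ggap t0v s0_ge0 s0s fgap ab).
  move=> s' t' tau' cN' s'0 t'0 tau'0 Es' Et'.
  by rewrite [q * p]mulrC [s' * t']mulrC; apply: IH; rewrite // addnC.
by rewrite addnC.
Qed.

Lemma prekopa_leindler (T : finType) (f g : T -> R) (M : R) :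
  (forall x, 0 <= f x) -> (forall x, 0 <= g x) -> level_bound f g ->
  (forall r, 0 <= r -> H r <= M) ->
  Num.sqrt ((\sum_x f x) * (\sum_x g x)) <= M.
Proof.
move=> f0 g0 fg HM.
have M0 : 0 <= M by apply: le_trans (HM 0 (lexx 0)); apply: H_ge0.
have sum_trunc (h : T -> R) : (forall x, 0 <= h x) -> trunc h (\sum_x h x) = \sum_x h x.
  move=> h0; apply: eq_bigr => x _; apply: min_l.
  by rewrite (bigD1 x) //= lerDl sumr_ge0.
have : 0 <= \sum_x f x by apply: sumr_ge0.
rewrite le_eqVlt => /predU1P[<-|p0]; first by rewrite mul0r sqrtr0.
have : 0 <= \sum_x g x by apply: sumr_ge0.
rewrite le_eqVlt => /predU1P[<-|q0]; first by rewrite mulr0 sqrtr0.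
(* Truncating a nonnegative function at its own sum changes nothing, so these heights correspond to
   [tau = 1]. *)
rewrite -[leLHS]mulr1; apply: le_trans (HM (Num.sqrt ((\sum_x f x) * (\sum_x g x))) (sqrtr_ge0 _)).
apply: (layer_transport f0 g0 fg p0 q0 (ltnSn _)); rewrite ?ltW //.
  by rewrite mulr1 sum_trunc.
by rewrite mulr1 sum_trunc.
Qed.

End PrekopaLeindler.

(** * The isoperimetric profile *)

Section Profile.
Variables (R : realType) (n : nat).

Let pow_gt0 : 0 < 2 ^+ n :> R. Proof. exact: exprn_gt0. Qed.

Let ratio_ge0 m : 0 <= m%:R / 2 ^+ n :> R.
Proof. by rewrite divr_ge0 // ltW. Qed.

Let ratio_le1 m : (m <= 2 ^ n)%N -> m%:R / 2 ^+ n <= 1 :> R.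
Proof. by move=> le; rewrite ler_pdivrMr // mul1r -natrX ler_nat. Qed.

Let card_le (A : {set cube n}) : (#|A| <= 2 ^ n)%N.
Proof. by rewrite -card_cube max_card. Qed.

Lemma hamming_sym (x y : cube n) : hamming x y = hamming y x.
Proof. by rewrite !hamming_dist; apply: eq_bigr => i _; rewrite addbC. Qed.

(** For [j < n], [B] misses the enlargement of [A] by [n - j - 1], which by Harper is at least as
    large as that of the segment of size [#|A|]; this size is one of the indices in the maximum. For
    larger [j] the profile is 1. *)
Lemma isoF_bound (A B : {set cube n}) (j : nat) :
  (forall x y, x \in A -> y \in B -> (n - j <= hamming x y)%N) ->
  Num.sqrt (#|A|%:R * #|B|%:R) <= 2 ^+ n * isoF R n j.
Proof.
move=> AB.
have -> : Num.sqrt (#|A|%:R * #|B|%:R) =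
    2 ^+ n * Num.sqrt (#|A|%:R / 2 ^+ n * (#|B|%:R / 2 ^+ n)) :> R.
  rewrite -[X in X * Num.sqrt _]ger0_norm ?ltW // -sqrtr_sqr -sqrtrM ?sqr_ge0 //.
  by congr Num.sqrt; field; rewrite gt_eqF.
rewrite ler_pM2l //= /isoF; case: ifP => jn; last first.
  by rewrite -[leRHS]sqrtr1 ler_wsqrtr // mulr_ile1 ?ratio_le1.
set e := (n - j - 1)%N.
have disj : (#|B| + #|enlarge A e| <= 2 ^ n)%N.
  rewrite -card_cube -(cardsC (enlarge A e)) addnC leq_add2l subset_leq_card //.
  apply/subsetP => y yB; rewrite !inE; apply/exists_inP => -[x xA].
  by rewrite hamming_sym => yx; have := AB x y xA yB; rewrite /e in yx; lia.
have m2 : (#|A| < (2 ^ n).+1)%N by rewrite ltnS.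
apply: le_trans (le_bigmax _ _ (Ordinal m2)) => /=.
rewrite ler_wsqrtr // ler_wpM2l //.
rewrite ler_pdivrMr // mulrBl mul1r mulfVK ?gt_eqF // lerBrDr -natrD -natrX ler_nat.
by apply: leq_trans disj; rewrite leq_add2l harper_enlarge.
Qed.

Lemma deltaF0 : deltaF R n 0 = isoF R n 0.
Proof. by rewrite /deltaF subr0. Qed.

Lemma deltaFS j : deltaF R n j.+1 = isoF R n j.+1 - isoF R n j.
Proof. by rewrite /deltaF -addn1 PoszD addrK. Qed.

Lemma sum_deltaF j : \sum_(i < j.+1) deltaF R n i = isoF R n j.
Proof.
elim: j => [|j IH]; first by rewrite big_ord1 deltaF0.
by rewrite big_ord_recr IH /= deltaFS addrC subrK.
Qed.

(** Raising [j] shrinks the enlargement radius and so raises each term of the maximum; every term is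
    at most 1, the value from [n] on. *)
Lemma deltaF_ge0 j : 0 <= deltaF R n j.
Proof.
have isoF0 : 0 <= isoF R n 0.
  rewrite /isoF; case: ifP => // _; exact: bigmax_ge_id.
case: j => [|j]; first by rewrite deltaF0.
rewrite deltaFS subr_ge0 /isoF.
case: (ltnP j n) => jn; last by rewrite ltnNge ltnW.
case: ifP => jn'; apply: bigmax_le => //.
- exact: bigmax_ge_id.
- move=> m _; apply: le_trans (le_bigmax _ _ m) => /=.
  rewrite ler_wsqrtr // ler_wpM2l // lerB // ler_wpM2r ?invr_ge0 ?(ltW pow_gt0) //.
  by rewrite ler_nat subset_leq_card // enlargeS //; lia.
- move=> m _; rewrite -[leRHS]sqrtr1 ler_wsqrtr // mulr_ile1 //.
  + by rewrite subr_ge0 ratio_le1.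
  + by rewrite ratio_le1 // -ltnS.
  + by rewrite gerBl.
Qed.

End Profile.

(** * The functional inequality from the isoperimetric profile *)

Theorem theorem6p16 (R : realType) (n : nat) (hn : (2 <= n)%N)
    (Omega : 'I_n.+1 -> R)
    (Omega_ge0 : forall j : 'I_n.+1, 0 <= Omega j)
    (Omega_noninc : forall i j : 'I_n.+1, (i <= j)%N -> Omega j <= Omega i)
    (f g : cube n -> R)
    (f_ge0 : forall x : cube n, 0 <= f x)
    (g_ge0 : forall x : cube n, 0 <= g x)
    (hfg : forall x y : cube n,
       Num.sqrt (f x * g y) <= Omega (inord (n - hamming x y))) :
  Num.sqrt (cube_integral f * cube_integral g)
    <= \sum_(j < n.+1) Omega j * deltaF R n j.
Proof.
have pow_gt0 : 0 < 2 ^+ n :> R by exact: exprn_gt0.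
(* The factor 2 ^ n appears because level sets are counted, not measured. *)
pose H (r : R) := 2 ^+ n * \sum_(j < n.+1) Num.min r (Omega j) * deltaF R n j.
have H_mono r r' : r <= r' -> H r <= H r'.
  move=> rr; rewrite ler_pM2l //; apply: ler_sum => j _.
  by rewrite ler_wpM2r ?deltaF_ge0 // le_min2 // lexx.
have H_ge0 r : 0 <= r -> 0 <= H r.
  move=> r0; apply: mulr_ge0; first exact: ltW.
  by apply: sumr_ge0 => j _; rewrite mulr_ge0 ?deltaF_ge0 // le_min r0 Omega_ge0.
have H_le r : 0 <= r -> H r <= 2 ^+ n * \sum_(j < n.+1) Omega j * deltaF R n j.
  move=> _; rewrite ler_pM2l //; apply: ler_sum => j _.
  by rewrite ler_wpM2r ?deltaF_ge0 // ge_min lexx orbT.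
(* For [i <= j] monotonicity of [Omega] makes both minima inactive, and these increments telescope
   to [isoF R n j]; the other terms are nonnegative. *)
have H_step r r' (j : 'I_n.+1) : r <= r' -> r' <= Omega j ->
    (r' - r) * (2 ^+ n * isoF R n j) <= H r' - H r.
  move=> rr rj; rewrite /H -mulrBr mulrCA ler_pM2l // -sumrB -sum_deltaF.
  rewrite (big_ord_widen n.+1 (deltaF R n)) ?ltn_ord // mulr_sumr big_mkcond.
  apply: ler_sum => i _; rewrite -mulrBl; case: ifP => [ij|_].
    have ri : r' <= Omega i by apply: le_trans rj _; apply: Omega_noninc.
    by rewrite !min_l // (le_trans rr).
  by rewrite mulr_ge0 ?deltaF_ge0 // subr_ge0 le_min2 ?lexx.
have fg : level_bound H f g.
  move=> s s' t t' s0 ss t0 tt.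
  have rr : Num.sqrt (s * t) <= Num.sqrt (s' * t').
    by rewrite ler_wsqrtr // ler_pM.
  have [A0|[x0 x0A]] := set_0Vmem (level f s').
    by rewrite A0 cards0 mul0r sqrtr0 mulr0 subr_ge0 H_mono.
  have [B0|[y0 y0B]] := set_0Vmem (level g t').
    by rewrite B0 cards0 mulr0 sqrtr0 mulr0 subr_ge0 H_mono.
  have lvl x y : x \in level f s' -> y \in level g t' ->
      Num.sqrt (s' * t') <= Omega (inord (n - hamming x y)).
    rewrite !inE => sx ty; apply: le_trans (hfg x y).
    by rewrite ler_wsqrtr // ler_pM // ?(le_trans s0 ss) ?(le_trans t0 tt).
  (* [j] is the largest index whose [Omega] value is at least the geometric mean of the heights. By
     [lvl], [n - hamming x y] is such an index for every pair in the level sets, so it is at most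
     [j]: the sets are at distance at least [n - j]. *)
  have [j jP jmax] := arg_maxnP (P := fun j => Num.sqrt (s' * t') <= Omega j)
    val (lvl x0 y0 x0A y0B).
  apply: le_trans (H_step _ _ j rr jP); rewrite ler_wpM2l ?subr_ge0 //.
  apply: isoF_bound => x y xA yB; have := jmax _ (lvl x y xA yB).
  rewrite /= inordK; lia.
have pl := prekopa_leindler H_ge0 f_ge0 g_ge0 fg H_le.
rewrite /cube_integral -!mulr_suml mulrACA -expr2 mulrC sqrtrM ?sqr_ge0 //.
rewrite sqrtr_sqr ger0_norm ?invr_ge0 ?(ltW pow_gt0) //.
by rewrite mulrC ler_pdivrMr // [leRHS]mulrC.
Qed.
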